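(* In the setting of the context, let $A$ denote the two-stage adaptive algorithm defined there, and set $$\mathfrak C=\frac1{1-\tau h_+(n_{\widetilde F})},\qquad \tilde{\mathfrak c}=1+\tau h_-(n_{\widetilde F}),\qquad \mathfrak c=1+\tau_{\min}h_-(n_{\widetilde F}).$$ Then $A\in\mathcal A(\mathcal C_\tau,\mathcal G,S,\Lambda)$ is successful: $\|S(f)-A(f,\varepsilon)\|_{\mathcal G}\le\varepsilon$ for all $f\in\mathcal C_\tau$ and $\varepsilon>0$. Moreover, for all $f\in\mathcal C_\tau$ and $\varepsilon>0$, $$n_{\widetilde F}+h^{-1}\!\left(\frac{\varepsilon}{|f|_{\mathcal F}}\right)\le n_{\widetilde F}+h^{-1}\!\left(\frac{\varepsilon}{\tau|f|_{\widetilde{\mathcal F}}}\right)\le \operatorname{cost}(A,f,\varepsilon),$$ $$\operatorname{cost}(A,f,\varepsilon)\le n_{\widetilde F}+h^{-1}\!\left(\frac{\varepsilon}{\tau\,\mathfrak C\,\tilde{\mathfrak c}\,|f|_{\widetilde{\mathcal F}}}\right)\quad\text{and}\quad \operatorname{cost}(A,f,\varepsilon)\le n_{\widetilde F}+h^{-1}\!\left(\frac{\tau_{\min}\,\varepsilon}{\tau\,\mathfrak C\,\mathfrak c\,|f|_{\mathcal F}}\right).$$ Finally, $A$ is computationally stable, both for $\mathcal F$-balls and for $\widetilde{\mathcal F}$-balls: for each of the two semi-norms $|\cdot|_*\in\{|\cdot|_{\mathcal F},|\cdot|_{\widetilde{\mathcal F}}\}$, $$\sup_{\varepsilon,s>0}\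 \frac{\sup\{\operatorname{cost}(A,f,\varepsilon):f\in\mathcal C_\tau,\ |f|_*\le s\}}{\max\bigl(1,\ \inf\{\operatorname{cost}(A,f,\varepsilon):f\in\mathcal C_\tau,\ |f|_*\ge s\}\bigr)}<\infty .$$
   Context: **Problem.** $\mathcal F$ is a real linear space of functions with semi-norms $|\cdot|_{\mathcal F}$ and $|\cdot|_{\widetilde{\mathcal F}}$; $\tau_{\min}>0$ satisfies $\tau_{\min}|f|_{\widetilde{\mathcal F}}\le|f|_{\mathcal F}$ for all $f\in\mathcal F$. $\mathcal G$ is a real normed space with norm $\|\cdot\|_{\mathcal G}$, and the solution operator $S:\mathcal F\to\mathcal G$ satisfies $S(cf)=cS(f)$ for $c\ge 0$. For a fixed $\tau>0$, $\mathcal C_\tau=\{f\in\mathcal F:|f|_{\mathcal F}\le\tau|f|_{\widetilde{\mathcal F}}\}$. **Algorithms and cost.** $\Lambda$ is a set of real-valued functions $L$ on $\mathcal F$ with $L(cf)=cL(f)$ for all $c\in\mathbb R$; each $L\in\Lambda$ has a cost $\$(L)\in\mathbb N$. For $\mathcal N\subseteq\mathcal F$, $\mathcal A(\mathcal N,\mathcal G,S,\Lambda)$ is the set of deterministic algorithms $A:\mathcal N\times(0,\infty)\to\mathcal G$ of the form $A(f,\varepsilon)=\phi(L_1(f),\dots,L_m(f))$ with $L_i\in\Lambda$, where $m$ may depend on $\varepsilon$ and the observed values $L_i(f)$, and each $L_i$ may depend on $L_1(f),\dots,L_{i-1}(f)$; $\operatorname{cost}(A,f,\varepsilon)=\$(L_1)+\dots+\$(L_m)$.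 A fixed-cost algorithm is defined for all $f\in\mathcal F$, has $m$ and the $L_i$ independent of $f$ and $\varepsilon$, and is positively homogeneous in $f$. **Building blocks.** $\mathcal I=\{N_1<N_2<\cdots\}\subseteq\mathbb N_0$ with $\sup_{i\ge2}N_{i+1}/N_i<\infty$. $\{A_n\}_{n\in\mathcal I}$ are fixed-cost algorithms $A_n:\mathcal F\to\mathcal G$ (using data from $\Lambda$) with $\operatorname{cost}(A_n)=n$ and $\|S(f)-A_n(f)\|_{\mathcal G}\le h(n)|f|_{\mathcal F}$ for all $f\in\mathcal F$, where $h:\mathcal I\to[0,\infty)$ is non-increasing and $\inf_{n\in\mathcal I} h(n)=0$. Put $h^{-1}(\varepsilon)=\min\{n\in\mathcal I:h(n)\le\varepsilon\}$ for $\varepsilon>0$ and assume $\sup_{\varepsilon>0}h^{-1}(\varepsilon)/\max(1,h^{-1}(2\varepsilon))<\infty$. $\{\widetilde F_n\}_{n\in\mathcal I}$ are fixed-cost algorithms $\widetilde F_n:\mathcal F\to[0,\infty)$ (using data from $\Lambda$) with cost $n$ and $$-h_-(n)|f|_{\mathcal F}\le|f|_{\widetilde{\mathcal F}}-\widetilde F_n(f)\le h_+(n)|f|_{\mathcal F}\qquad\forall f\in\mathcal F,$$ where $h_\pm:\mathcal I\to[0,\infty)$ are non-increasing with $\inf_{n\in\mathcal I} h_\pm(n)=0$. **Two-stage adaptive algorithm $A$.** Fix $n_{\widetilde F}\in\mathcal I$ with $h_+(n_{\widetilde F})<1/\tau$, and set $\mathfrak C=1/(1-\tau h_+(n_{\widetilde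 F}))$. Given $\varepsilon>0$ and $f\in\mathcal C_\tau$: (Stage 1) compute $\widetilde F_{n_{\widetilde F}}(f)$; (Stage 2) put $n_A=h^{-1}\bigl(\varepsilon/(\tau\,\mathfrak C\,\widetilde F_{n_{\widetilde F}}(f))\bigr)$ and return $A(f,\varepsilon)=A_{n_A}(f)$. The total cost is $n_{\widetilde F}+n_A$. **Conventions.** $\varepsilon/0=+\infty$ and $h^{-1}(+\infty)=\min\mathcal I$; the infimum of the empty set is $+\infty$ (and a finite number divided by $+\infty$ is $0$). *)

(* Defs.v *)
From HB Require Import structures.
From mathcomp Require Import all_boot all_order all_algebra.
From mathcomp Require Import all_classical all_reals all_analysis.

Set Implicit Arguments.
Unset Strict Implicit.
Unset Printing Implicit Defensive.

Import Order.TTheory GRing.Theory Num.Theory.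
Import numFieldNormedType.Exports.

Local Open Scope classical_set_scope.
Local Open Scope ring_scope.

(* The library's semi-norm is a structure carried by the type; two semi-norms
   on one space require a predicate. *)
Definition seminorm (R : realType) (V : lmodType R) (p : V -> R) : Prop :=
  [/\ forall v, 0 <= p v,
      forall u v, p (u + v) <= p u + p v &
      forall (c : R) v, p (c *: v) = `|c| * p v].

Definition pos_homogeneous (R : realType) (V W : lmodType R) (T : V -> W) :
  Prop := forall (c : R) (v : V), 0 <= c -> T (c *: v) = c *: T v.

Definition cone (R : realType) (F : lmodType R) (nF nFt : F -> R) (tau : R) :
  set F := [set f | nF f <= tau * nFt f].

Section algorithms.
Context {R : realType} {F : lmodType R}.
Variables (Lam : set (F -> R)) (cost : (F -> R) -> nat).

(* The first m values observed on f, when L maps the values observed so far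
   to the next functional to be evaluated. *)
Fixpoint observed (L : seq R -> F -> R) (f : F) (m : nat) : seq R :=
  if m is k.+1 then let y := observed L f k in rcons y (L y f) else [::].

(* A, with cost function costA, belongs to the class of adaptive algorithms
   on N.  The number of observations is the first m at which the stopping rule
   accepts the observed values, so that it depends on f only through them.
   Values of A and costA at (f, eps) with f outside N or eps <= 0 are
   irrelevant. *)
Definition adaptive_algorithm (G : Type) (N : set F)
    (A : F -> R -> G) (costA : F -> R -> nat) : Prop :=
  exists (L : R -> seq R -> F -> R) (stop : R -> pred (seq R))
         (phi : R -> seq R -> G),
  forall (f : F) (eps : R), N f -> 0 < eps ->
  exists m : nat, let y := observed (L eps) f in
    [/\ stop eps (y m),
        forall k, (k < m)%N -> ~~ stop eps (y k),
        forall k, (k < m)%N -> Lam (L eps (y k)),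
        A f eps = phi eps (y m) &
        costA f eps = (\sum_(k < m) cost (L eps (y k)))%N].

Definition fixed_cost_algorithm (V : lmodType R) (A : F -> V) (n : nat) :
  Prop :=
  pos_homogeneous A /\
  exists (m : nat) (L : 'I_m -> F -> R) (phi : m.-tuple R -> V),
    [/\ forall i, Lam (L i),
        forall f, A f = phi [tuple L i f | i < m] &
        n = (\sum_(i < m) cost (L i))%N].

End algorithms.

Section complexity.
Context {R : realType}.
Variables (I : set nat) (h : nat -> R).

(* min {n in I | h n <= x}, and 0 if there is no such n; the argument is
   extended so that the value at +oo is min I. *)
Definition hinv (x : \bar R) : nat :=
  xget 0%N [set n | [/\ I n, ((h n)%:E <= x)%E &
                        forall k, I k -> ((h k)%:E <= x)%E -> (n <= k)%N]].

End complexity.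

Section two_stage.
Context {R : realType} {F : lmodType R} {G : Type}.
Variables (I : set nat) (h : nat -> R) (tau C : R).
Variables (A : nat -> F -> G) (Ft : nat -> F -> R) (nFt : nat).

(* Division in \bar R satisfies eps / 0 = +oo. *)
Definition stage2_index (f : F) (eps : R) : nat :=
  hinv I h (eps%:E / (tau * C * Ft nFt f)%:E)%E.

Definition two_stage (f : F) (eps : R) : G := A (stage2_index f eps) f.

Definition two_stage_cost (f : F) (eps : R) : nat :=
  (nFt + stage2_index f eps)%N.

End two_stage.

(* A finite numerator over +oo gives 0; the library also has +oo / +oo = 0,
   which is excluded here. *)
Definition cost_ratio (R : realType) (x y : \bar R) : \bar R :=
  if x == +oo%E then +oo%E else (x / y)%E.

Definition computationally_stable (R : realType) (F : lmodType R)
    (N : set F) (costA : F -> R -> nat) (norm : F -> R) : Prop :=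
  (ereal_sup [set cost_ratio
      (ereal_sup [set ((costA f es.1)%:R : R)%:E
                 | f in [set f | N f /\ (norm f <= es.2)%R]])
      (maxe 1 (ereal_inf [set ((costA f es.1)%:R : R)%:E
                         | f in [set f | N f /\ (es.2 <= norm f)%R]]))
    | es in [set es : R * R | (0 < es.1)%R /\ (0 < es.2)%R]] < +oo)%E.

(* Main.v *)
(** On the cone, the first-stage estimate [Ft] pins down both semi-norms up to
    constants: [nF <= tau * nFt <= tau * C * Ft], while [Ft <= ct * nFt] and
    [Ft <= (c / taumin) * nF].  The first chain gives success and the lower cost
    bounds, the last two inequalities the upper ones, because [hinv] is
    antitone.  Hence for either semi-norm the cost of [f] lies between
    [nFtil + hinv (eps / (b * norm f))] and [nFtil + hinv (eps / (a * norm f))]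
    with constants [a, b > 0], and the doubling property of [hinv], iterated
    until [2 ^ k] exceeds [a / b], makes these bounds comparable at
    [norm f = s]. *)
Require Import Defs.
From mathcomp Require Import all_boot all_order all_algebra.
From mathcomp Require Import all_classical all_reals all_analysis.
From mathcomp Require Import ring lra.
Import Order.TTheory GRing.Theory Num.Theory.
Import numFieldNormedType.Exports.
Local Open Scope classical_set_scope.
Local Open Scope ring_scope.

(** * Assembling fixed-cost stages into one adaptive algorithm *)

(** Data indexed by [nat] and [seq], in place of ordinals and tuples, can be concatenated across two
    stages. *)
Lemma fixed_cost_algorithm_seq {R : realType} {F V : lmodType R}
    {Lam : set (F -> R)} {cost : (F -> R) -> nat} {A : F -> V} {n : nat} :
  fixed_cost_algorithm Lam cost A n ->
  exists p : nat * (nat -> F -> R) * (seq R -> V),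
    [/\ forall i, (i < p.1.1)%N -> Lam (p.1.2 i),
        forall f, A f = p.2 (mkseq (fun i => p.1.2 i f) p.1.1) &
        n = (\sum_(i < p.1.1) cost (p.1.2 i))%N].
Proof.
move=> [_ [m [L [phi [LamL AE nE]]]]].
pose L' i f := if insub i is Some j then L j f else 0.
have L'E (i : 'I_m) : L' i = L i by apply/funext => f; rewrite /L' valK.
exists (m, L', fun y => phi [tuple nth 0 y i | i < m]); split => /=.
- by move=> i im; rewrite (L'E (Ordinal im)).
- move=> f; rewrite AE; congr phi; apply: eq_from_tnth => i.
  by rewrite !tnth_mktuple nth_mkseq // L'E.
- by rewrite nE; apply: eq_bigr => i _; rewrite L'E.
Qed.

Lemma observed_mkseq {R : realType} {F : lmodType R} (L : seq R -> F -> R)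
    (M : nat -> F -> R) (f : F) (m : nat) :
  (forall k, (k < m)%N -> L (mkseq (M ^~ f) k) f = M k f) ->
  forall k, (k <= m)%N -> observed L f k = mkseq (M ^~ f) k.
Proof.
by move=> LM; elim=> [//|k IH] km /=; rewrite IH ?mkseqS ?LM // ltnW.
Qed.

(** The first [mB] functionals are those of [B], the same for every [f]. Their values determine
    [idx (B f) eps], so the second-stage functionals and the stopping length can be read off from a
    prefix of the observed values. *)
Lemma adaptive_two_stage {R : realType} {F V G : lmodType R}
    (Lam : set (F -> R)) (cost : (F -> R) -> nat) (I : set nat) (N : set F)
    (B : F -> V) (nB : nat) (A : nat -> F -> G) (idx : V -> R -> nat) :
  fixed_cost_algorithm Lam cost B nB ->
  (forall n, I n -> fixed_cost_algorithm Lam cost (A n) n) ->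
  (forall f eps, N f -> 0 < eps -> I (idx (B f) eps)) ->
  adaptive_algorithm Lam cost N (fun f eps => A (idx (B f) eps) f)
    (fun f eps => (nB + idx (B f) eps)%N).
Proof.
move=> /fixed_cost_algorithm_seq [[[mB LB] phiB] /= [LamB BE nBE]] HA idxI.
(* Data are chosen for all [n] at once, since the index emerges only from the observed values;
   outside [I] they are placeholders. *)
have /choice[p pP] (n : nat) : exists p : nat * (nat -> F -> R) * (seq R -> G),
    I n -> [/\ forall i, (i < p.1.1)%N -> Lam (p.1.2 i),
        forall f, A n f = p.2 (mkseq (fun i => p.1.2 i f) p.1.1) &
        n = (\sum_(i < p.1.1) cost (p.1.2 i))%N].
  have [/HA/fixed_cost_algorithm_seq[q qP]|nI] := pselect (I n).
    by exists q.
  by exists (0%N, fun _ _ => 0, fun=> 0) => /nI.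
pose ix eps y := idx (phiB (take mB y)) eps.
pose L eps y := if (size y < mB)%N then LB (size y)
                else (p (ix eps y)).1.2 (size y - mB)%N.
exists L, (fun eps y => size y == mB + (p (ix eps y)).1.1)%N,
  (fun eps y => (p (ix eps y)).2 (drop mB y)) => f eps Nf eps0.
set n := idx (B f) eps.
have [Lamn An nE] := pP n (idxI _ _ Nf eps0).
(* The functionals that [L eps] selects along this particular [f]. *)
pose M k := if (k < mB)%N then LB k else (p n).1.2 (k - mB)%N.
have takeM k : (mB <= k)%N ->
    take mB (mkseq (M ^~ f) k) = mkseq (fun i => LB i f) mB.
  move=> mBk; rewrite /mkseq -map_take take_iota (minn_idPl mBk).
  by apply/eq_in_map => i; rewrite mem_iota /= add0n /M => ->.
have ixE k : (mB <= k)%N -> ix eps (mkseq (M ^~ f) k) = n.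
  by move=> mBk; rewrite /ix takeM // -BE.
have LE k : L eps (mkseq (M ^~ f) k) = M k.
  rewrite /L /M size_mkseq; case: ltnP => // mBk.
  by rewrite ixE.
have obsE k : observed (L eps) f k = mkseq (M ^~ f) k.
  by apply: (observed_mkseq _ _ _ k) => // j _; rewrite LE.
exists (mB + (p n).1.1)%N; rewrite /= !obsE; split.
- by rewrite size_mkseq ixE ?leq_addr.
- move=> k km; rewrite obsE size_mkseq.
  (* For [k < mB] the value of [ix] is arbitrary, but every stopping length is at least [mB]. *)
  have [mBk|kmB] := leqP mB k; first by rewrite ixE // ltn_eqF.
  by rewrite ltn_eqF // (leq_trans kmB) // leq_addr.
- move=> k km; rewrite obsE LE /M; case: ltnP => [/LamB//|mBk].
  by apply: Lamn; rewrite ltn_subLR.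
- rewrite ixE ?leq_addr // An; congr (_.2 _).
  rewrite /mkseq -map_drop drop_iota addKn addnC iotaDl -map_comp.
  apply: seq.eq_map => i /=.
  by rewrite /M ltnNge leq_addr /= addKn.
- rewrite big_split_ord /= nBE {1}nE; congr addn; apply: eq_bigr => i _.
    by rewrite obsE LE /M ltn_ord.
  by rewrite obsE LE /M ltnNge leq_addr /= addKn.
Qed.

(** * Extended-real quotients and the behaviour of [hinv] *)

Lemma lee_divr_denom {R : realType} (x d d' : R) :
  0 <= x -> 0 <= d -> d <= d' -> (x%:E / d'%:E <= x%:E / d%:E)%E.
Proof.
move=> x0 d0 dd'; apply: lee_wpmul2l; first by rewrite lee_fin.
by rewrite lee_pV2 ?inE ?lee_fin // (le_trans d0).
Qed.

Lemma ediv_gt0 {R : realType} (x d : R) :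
  0 < x -> 0 <= d -> (0 < x%:E / d%:E)%E.
Proof.
move=> x0 d0; rewrite mule_gt0 ?lte_fin // inver.
by case: eqP => [//|/eqP dn0]; rewrite ltry || rewrite lte_fin invr_gt0 lt0r dn0.
Qed.

(** For [d = 0] both sides are [+oo], because both numerators are positive. *)
Lemma ediv_scale {R : realType} (t x d : R) : 0 < t -> 0 < x ->
  ((t * x)%:E / d%:E = x%:E / (d / t)%:E)%E.
Proof.
move=> t0 x0; have t_neq0 : t != 0 by rewrite gt_eqF.
rewrite !inver mulf_eq0 invr_eq0 (negbTE t_neq0) orbF.
case: eqP => [_|/eqP d0]; first by rewrite !gt0_muley ?lte_fin ?mulr_gt0.
by rewrite -!EFinM; congr EFin; field; apply/andP.
Qed.

Section hinv_theory.
Context {R : realType} {I : set nat} {h : nat -> R}.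
Hypotheses (I_neq0 : I !=set0) (h_inf : inf [set h n | n in I] = 0).

(** Since [h] has infimum 0 on [I], a positive [x] admits some [n], so the default value in [hinv]
    never occurs. *)
Lemma hinvP {x : \bar R} : (0 < x)%E ->
  [/\ I (hinv I h x), ((h (hinv I h x))%:E <= x)%E &
      forall k, I k -> ((h k)%:E <= x)%E -> (hinv I h x <= k)%N].
Proof.
move=> x0; rewrite /hinv; case: xgetP => [n _ //|noP].
have [n0 In0 hn0] : exists2 n, I n & ((h n)%:E <= x)%E.
  case: x x0 {noP} => [r|_|//]; last first.
    by have [n In] := I_neq0; exists n; rewrite ?leey.
  rewrite lte_fin -{1}h_inf => /inf_lt[|_ [n In <-] /ltW hr].
    by have [n In] := I_neq0; exists (h n), n.
  by exists n; rewrite ?lee_fin.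
have exn : exists n, `[< I n /\ ((h n)%:E <= x)%E >] by exists n0; apply/asboolP.
case: (ex_minnP exn) => m /asboolP[Im hm] m_min.
case: (noP m); split => // k Ik hk.
by apply: m_min; apply/asboolP.
Qed.

Lemma hinv_anti {x y : \bar R} :
  (0 < x)%E -> (x <= y)%E -> (hinv I h y <= hinv I h x)%N.
Proof.
move=> x0 xy; have [_ _] := hinvP (lt_le_trans x0 xy); apply.
  by have [] := hinvP x0.
by have [_ /le_trans -> ] := hinvP x0.
Qed.

Lemma hinv_anti_div {e d d' : R} : 0 < e -> 0 <= d -> d <= d' ->
  (hinv I h (e%:E / d%:E)%E <= hinv I h (e%:E / d'%:E)%E)%N.
Proof.
move=> e0 d0 dd'; apply: hinv_anti; last exact: lee_divr_denom (ltW e0) _ _.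
exact: ediv_gt0 e0 (le_trans d0 dd').
Qed.

Section doubling.
Variable B : R.
Hypotheses (B1 : 1 <= B) (doubling : forall e : R, 0 < e ->
  (hinv I h e%:E)%:R <= B * Num.max 1 (hinv I h (2 * e)%:E)%:R).

Lemma hinv_pow2 (k : nat) {e : R} : 0 < e ->
  (hinv I h e%:E)%:R <= B ^+ k * Num.max 1 (hinv I h (2 ^+ k * e)%:E)%:R.
Proof.
move=> e0; elim: k => [|k IH]; first by rewrite !expr0 !mul1r le_max lexx orbT.
have B0 : 0 <= B by rewrite (le_trans _ B1).
apply: (le_trans IH); rewrite exprSr -mulrA ler_wpM2l ?exprn_ge0 //.
rewrite exprS -mulrA ge_max doubling ?mulr_gt0 ?exprn_gt0 // andbT.
(* The 1 inside the maximum is absorbed thanks to [1 <= B]. *)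
by rewrite (le_trans B1) // ler_peMr // le_max lexx.
Qed.

(** With [a / b <= 2 ^+ k], monotonicity and [k] doublings give [D = B ^+ k], which does not depend
    on [e]. *)
Lemma hinv_scale (a b : R) : 0 < a -> 0 < b ->
  exists2 D : R, 0 <= D & forall e : R, 0 < e ->
  (hinv I h (e / a)%:E)%:R <= D * Num.max 1 (hinv I h (e / b)%:E)%:R.
Proof.
move=> a0 b0; set k := Num.Def.archi_bound (a / b).
have B0 : 0 <= B by rewrite (le_trans _ B1).
exists (B ^+ k) => [|e e0]; first by rewrite exprn_ge0.
have ea0 : 0 < e / a by rewrite divr_gt0.
apply: (le_trans (hinv_pow2 k ea0)).
rewrite ler_wpM2l ?exprn_ge0 // ge_max le_max lexx /=.
rewrite le_max ler_nat; apply/orP; right; apply: hinv_anti.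
  by rewrite lte_fin divr_gt0.
rewrite lee_fin; have -> : e / b = a / b * (e / a) by field; rewrite !gt_eqF.
by rewrite ler_pM2r // ltW // upper_nthrootP.
Qed.

End doubling.

End hinv_theory.

(** * Computational stability from two-sided cost bounds *)

Lemma ereal_sup_lty_bounded {R : realType} {T : Type} {P : set T} {f : T -> R} :
  (ereal_sup [set (f x)%:E | x in P] < +oo)%E ->
  exists M : R, forall x, P x -> f x <= M.
Proof.
have := @ereal_sup_ubound _ [set (f x)%:E | x in P].
case: ereal_sup => [M|//|] fM _.
  by exists M => x Px; rewrite -lee_fin; apply: fM; exists x.
(* A supremum equal to [-oo] forces [P] to be empty. *)
exists 0 => x Px; have := fM (f x)%:E.
by rewrite leeNy_eq => /(_ (ex_intro2 _ _ x Px erefl)).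
Qed.

(** The finite bound [X] rules out [x = +oo]; an infinite [y] gives 0, and [x = -oo] is the supremum
    over an empty set. *)
Lemma cost_ratio_le {R : realType} (x y : \bar R) (X Y : R) :
  0 <= X -> 0 < Y -> (x <= X%:E)%E -> (Y%:E <= y)%E ->
  (cost_ratio x y <= (X / Y)%:E)%E.
Proof.
move=> X0 Y0 xX Yy; have XY0 : 0 <= X / Y by rewrite divr_ge0 // ltW.
rewrite /cost_ratio; case: eqP => [xy|_]; first by rewrite xy in xX.
case: y Yy => [r||//] => [|_]; last by rewrite invey mule0 lee_fin.
rewrite lee_fin => Yr; have r0 := lt_le_trans Y0 Yr.
rewrite inver gt_eqF //; case: x xX => [s|//|_]; last first.
  by rewrite gt0_mulNye ?lte_fin ?invr_gt0 // leNye.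
rewrite -EFinM !lee_fin => sX; apply: (@le_trans _ _ (X / r)).
  by rewrite ler_pM2r ?invr_gt0.
by rewrite ler_wpM2l // lef_pV2 ?posrE.
Qed.

Lemma computationally_stable_hinv {R : realType} {F : lmodType R}
    (I : set nat) (h : nat -> R) (N : set F) (costA : F -> R -> nat)
    (norm : F -> R) (n0 : nat) (a b B : R) :
  I !=set0 -> inf [set h n | n in I] = 0 -> 1 <= B ->
  (forall e : R, 0 < e ->
    (hinv I h e%:E)%:R <= B * Num.max 1 (hinv I h (2 * e)%:E)%:R) ->
  0 < a -> 0 < b -> (forall f, 0 <= norm f) ->
  (forall f eps, N f -> 0 < eps ->
    (n0 + hinv I h (eps%:E / (b * norm f)%:E)%E <= costA f eps)%N) ->
  (forall f eps, N f -> 0 < eps ->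
    (costA f eps <= n0 + hinv I h (eps%:E / (a * norm f)%:E)%E)%N) ->
  computationally_stable N costA norm.
Proof.
move=> I0 h_inf B1 doubling a0 b0 norm0 lower upper.
have [D D0 hD] := hinv_scale I0 h_inf B B1 doubling a b a0 b0.
(* In the bound [1 + D], the 1 pays for [n0] and [D] for the [hinv] term. *)
rewrite /computationally_stable; apply: (@le_lt_trans _ _ (1 + D)%:E); last first.
  exact: ltry.
apply: ge_ereal_sup => _ [[eps s] /= [eps0 s0] <-].
have divE d : 0 < d -> (eps%:E / (d * s)%:E)%E = ((eps / s) / d)%:E.
  move=> d0; rewrite inver gt_eqF ?mulr_gt0 // -EFinM; congr EFin.
  by rewrite invfM mulrA mulrAC.
set X := (n0 + hinv I h ((eps / s) / a)%:E)%N.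
set Y := (n0 + hinv I h ((eps / s) / b)%:E)%N.
have Y0 : 0 < Num.max 1 Y%:R :> R by rewrite lt_max ltr01.
apply: (@le_trans _ _ (X%:R / Num.max 1 Y%:R)%:E); first last.
  rewrite lee_fin ler_pdivrMr // mulrDl mul1r natrD lerD //.
    by rewrite le_max ler_nat leq_addr orbT.
  apply: (le_trans (hD _ _)); first exact: divr_gt0.
  rewrite ler_wpM2l // ge_max le_max lexx /= le_max ler_nat leq_addl.
  by rewrite orbT.
apply: cost_ratio_le => //.
- apply: ge_ereal_sup => _ [f [Nf fs] <-]; rewrite lee_fin ler_nat.
  apply: (leq_trans (upper _ _ Nf eps0)); rewrite leq_add2l -divE //.
  by apply: hinv_anti_div => //; rewrite ?ler_pM2l // mulr_ge0 // ltW.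
- rewrite EFin_max ge_max !le_max lexx /=; apply/orP; right.
  apply: le_ereal_inf_tmp => _ [f [Nf fs] <-]; rewrite lee_fin ler_nat.
  apply: leq_trans (lower _ _ Nf eps0); rewrite leq_add2l -divE //.
  by apply: hinv_anti_div => //; rewrite ?ler_pM2l // mulr_ge0 // ltW.
Qed.

Theorem theorem2 (R : realType) (F : lmodType R) (G : normedModType R)
  (nF nFt : F -> R) (HnF : seminorm nF) (HnFt : seminorm nFt)
  (taumin : R) (Htaumin : 0 < taumin)
  (Hnorms : forall f : F, taumin * nFt f <= nF f)
  (S : F -> G) (HS : pos_homogeneous S)
  (tau : R) (Htau : 0 < tau)
  (Lam : set (F -> R))
  (HLam : forall L, Lam L -> forall (c : R) (f : F), L (c *: f) = c * L f)
  (cost : (F -> R) -> nat) (Hcost : forall L, Lam L -> (0 < cost L)%N)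
  (* the index set I = {N_0 < N_1 < N_2 < ... }, numbered from 0 *)
  (N : nat -> nat) (HN : forall i j : nat, (i < j)%N -> (N i < N j)%N)
  (HNratio : (ereal_sup [set ((N i.+1)%:R / (N i)%:R : R)%:E
                        | i in [set i : nat | (1 <= i)%N]] < +oo)%E)
  (I : set nat) (HI : I = range N)
  (h : nat -> R) (h_ge0 : forall n, I n -> 0 <= h n)
  (h_noninc : forall m n, I m -> I n -> (m <= n)%N -> h n <= h m)
  (h_inf : inf [set h n | n in I] = 0)
  (An : nat -> F -> G)
  (HAn : forall n, I n -> fixed_cost_algorithm Lam cost (An n) n)
  (HAn_err : forall n, I n -> forall f : F, `|S f - An n f| <= h n * nF f)
  (Hhinv : (ereal_sup
     [set ((hinv I h e%:E)%:R / Num.max 1 (hinv I h (2 * e)%:E)%:R : R)%:E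
     | e in [set e : R | (0 < e)%R]] < +oo)%E)
  (hm hp : nat -> R)
  (hm_ge0 : forall n, I n -> 0 <= hm n) (hp_ge0 : forall n, I n -> 0 <= hp n)
  (hm_noninc : forall m n, I m -> I n -> (m <= n)%N -> hm n <= hm m)
  (hp_noninc : forall m n, I m -> I n -> (m <= n)%N -> hp n <= hp m)
  (hm_inf : inf [set hm n | n in I] = 0) (hp_inf : inf [set hp n | n in I] = 0)
  (Ftn : nat -> F -> R)
  (HFtn : forall n, I n ->
     fixed_cost_algorithm Lam cost (Ftn n : F -> R^o) n)
  (Ftn_ge0 : forall n, I n -> forall f : F, 0 <= Ftn n f)
  (HFtn_err : forall n, I n -> forall f : F,
     - hm n * nF f <= nFt f - Ftn n f /\ nFt f - Ftn n f <= hp n * nF f)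
  (nFtil : nat) (HnFtil : I nFtil) (Hhp : hp nFtil < 1 / tau) :
  let C : R := 1 / (1 - tau * hp nFtil) in
  let ct : R := 1 + tau * hm nFtil in
  let c : R := 1 + taumin * hm nFtil in
  let Ctau : set F := cone nF nFt tau in
  let A : F -> R -> G := two_stage I h tau C An Ftn nFtil in
  let costA : F -> R -> nat := two_stage_cost I h tau C Ftn nFtil in
  [/\ adaptive_algorithm Lam cost Ctau A costA,
      forall (f : F) (eps : R), Ctau f -> 0 < eps -> `|S f - A f eps| <= eps,
      forall (f : F) (eps : R), Ctau f -> 0 < eps ->
        [/\ (nFtil + hinv I h (eps%:E / (nF f)%:E)%E
               <= nFtil + hinv I h (eps%:E / (tau * nFt f)%:E)%E)%N,
            (nFtil + hinv I h (eps%:E / (tau * nFt f)%:E)%E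
               <= costA f eps)%N,
            (costA f eps
               <= nFtil + hinv I h (eps%:E / (tau * C * ct * nFt f)%:E)%E)%N &
            (costA f eps
               <= nFtil + hinv I h
                    ((taumin * eps)%:E / (tau * C * c * nF f)%:E)%E)%N],
      computationally_stable Ctau costA nF &
      computationally_stable Ctau costA nFt].
Proof.
move=> C ct c Ctau A costA.
have [nF0 _ _] := HnF; have [nFt0 _ _] := HnFt.
have I0 : I !=set0 by exists nFtil.
have hp0 := hp_ge0 _ HnFtil; have hm0 := hm_ge0 _ HnFtil.
have thp : 0 < 1 - tau * hp nFtil.
  by move: Hhp; rewrite ltr_pdivlMr // mulrC subr_gt0.
have C0 : 0 < C by rewrite divr_gt0.
have ct0 : 0 < ct by rewrite ltr_pwDl // mulr_ge0 // ltW.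
have c0 : 0 < c by rewrite ltr_pwDl // mulr_ge0 // ltW.
have tC0 : 0 < tau * C by rewrite mulr_gt0.
have Ft0 := Ftn_ge0 _ HnFtil.
(* On the cone [nFt f - Ftn nFtil f <= hp nFtil * tau * nFt f]; solving for [nFt f] produces [C]. *)
have nFt_le f : Ctau f -> nFt f <= C * Ftn nFtil f.
  rewrite /Ctau /cone /= => nFf; have [_ err] := HFtn_err _ HnFtil f.
  have := ler_wpM2l hp0 nFf.
  by rewrite /C mul1r [_^-1 * _]mulrC ler_pdivlMr // mulrBr mulr1; lra.
have Ft_le f : Ctau f -> Ftn nFtil f <= ct * nFt f.
  rewrite /Ctau /cone /= => nFf; have [err _] := HFtn_err _ HnFtil f.
  have := ler_wpM2l hm0 nFf.
  by rewrite /ct; lra.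
have Ft_le_nF f : taumin * Ftn nFtil f <= c * nF f.
  have [err _] := HFtn_err _ HnFtil f; have := Hnorms f.
  have : taumin * (- hm nFtil * nF f) <= taumin * (nFt f - Ftn nFtil f).
    by rewrite ler_pM2l.
  by rewrite /c; lra.
clearbody C ct c.
have den0 f : 0 <= tau * C * Ftn nFtil f by rewrite mulr_ge0 // ltW.
have bounds f eps : Ctau f -> 0 < eps ->
    [/\ (nFtil + hinv I h (eps%:E / (nF f)%:E)%E
           <= nFtil + hinv I h (eps%:E / (tau * nFt f)%:E)%E)%N,
        (nFtil + hinv I h (eps%:E / (tau * nFt f)%:E)%E <= costA f eps)%N,
        (costA f eps
           <= nFtil + hinv I h (eps%:E / (tau * C * ct * nFt f)%:E)%E)%N &
        (costA f eps
           <= nFtil + hinv I h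
                ((taumin * eps)%:E / (tau * C * c * nF f)%:E)%E)%N].
  move=> Cf eps0.
  (* Each bound reduces to comparing denominators, once [taumin] has been moved from the numerator
     of the last one. *)
  rewrite !leq_add2l ediv_scale //; split; apply: hinv_anti_div => //.
  - by rewrite mulr_ge0 // ltW.
  - by rewrite -mulrA ler_pM2l // nFt_le.
  - by rewrite -[leRHS]mulrA ler_pM2l // Ft_le.
  - by rewrite ler_pdivlMr // -!mulrA !ler_pM2l // mulrC.
have [B B1 doubling] : exists2 B : R, 1 <= B & forall e : R, 0 < e ->
    (hinv I h e%:E)%:R <= B * Num.max 1 (hinv I h (2 * e)%:E)%:R.
  have [M hM] := ereal_sup_lty_bounded Hhinv.
  (* The maximum with 1 secures [1 <= B], which iterating the doubling requires. *)
  exists (Num.max 1 M) => [|e e0]; first by rewrite le_max lexx.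
  have max0 : 0 < Num.max 1 (hinv I h (2 * e)%:E)%:R :> R by rewrite lt_max ltr01.
  by rewrite -ler_pdivrMr // le_max hM ?orbT.
split => //.
- apply: (adaptive_two_stage Lam cost I Ctau (Ftn nFtil : F -> R^o) nFtil An
    (fun y eps => hinv I h (eps%:E / (tau * C * y)%:E)%E)) => //.
    exact: HFtn.
  by move=> f eps _ eps0; have [] := hinvP I0 h_inf (ediv_gt0 _ _ eps0 (den0 f)).
- move=> f eps Cf eps0.
  have [Iidx] := hinvP I0 h_inf (ediv_gt0 _ _ eps0 (den0 f)).
  rewrite -/(stage2_index I h tau C Ftn nFtil f eps) => h_le _.
  apply: (le_trans (HAn_err _ Iidx f)).
  set n := stage2_index _ _ _ _ _ _ _ _ in Iidx h_le *.
  have nF_le : nF f <= tau * C * Ftn nFtil f.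
    by rewrite (le_trans Cf) // -mulrA ler_pM2l // nFt_le.
  (* If [nF f = 0] the error bound vanishes for any index; otherwise the denominator is positive and
     the quotient is real. *)
  have [nF_eq0|nF_neq0] := eqVneq (nF f) 0; first by rewrite nF_eq0 mulr0 ltW.
  have den_gt0 : 0 < tau * C * Ftn nFtil f.
    by rewrite (lt_le_trans _ nF_le) // lt0r nF_neq0 nF0.
  rewrite inver gt_eqF // -EFinM lee_fin ler_pdivlMr // in h_le.
  by apply: le_trans h_le; apply: ler_wpM2l nF_le; exact: h_ge0.
(* The fourth cost bound supplies [a]; the first two, chained, give [b = 1]. *)
- apply: (computationally_stable_hinv I h Ctau costA nF nFtil
    (tau * C * c / taumin) 1 B) => //.
  + by rewrite divr_gt0 // mulr_gt0.
  + move=> f eps Cf eps0; rewrite mul1r.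
    by have [/leq_trans le1 /le1] := bounds f eps Cf eps0.
  + move=> f eps Cf eps0; have [_ _ _] := bounds f eps Cf eps0.
    by rewrite ediv_scale // mulrAC.
(* Here [a] comes from the third cost bound and [b] from the second. *)
- apply: (computationally_stable_hinv I h Ctau costA nFt nFtil
    (tau * C * ct) tau B) => //.
  + by rewrite mulr_gt0.
  + by move=> f eps Cf eps0; have [] := bounds f eps Cf eps0.
  + by move=> f eps Cf eps0; have [] := bounds f eps Cf eps0.
Qed.
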